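(* Let $L>0$, $I=(0,L)$, $F(\xi)=(\xi^2-1)^2$, and consider the stationary problem $$Z''''-(F'(Z'))'=0\ \text{ in } I,\qquad F'(Z')-Z'''=Z''=0\ \text{ on }\partial I .$$ (i) Assume $L\le\pi/2$. Then, up to additive constants, the stationary problem admits only the affine solutions $Z_0\equiv0$ and $Z_{\pm1}(s)=\pm s$. (ii) Assume $L>\pi/2$ and let $m=\lfloor 2L/\pi\rfloor\in\mathbb{N}^*$. Beside the affine solutions $Z_0\equiv 0$, $Z_{\pm1}(s)=\pm s$, up to additive constants, the stationary problem admits exactly $2m$ nonaffine solutions, namely $Z_2,\dots,Z_{m+1}$, and their opposites $Z_{-i}=-Z_i$.
   Context: A solution of the stationary problem is a function $Z\in C^4(\overline I)$ satisfying it pointwise (prime denotes the derivative in $s\in I$). $F'(\xi)=4\xi(\xi^2-1)$. $\lfloor\cdot\rfloor$ is the integer part.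
   Formalization: In (ii), the count of exactly 2m nonaffine solutions is claimed only when 2L/π is not an integer; when 2L/π = m is an integer the count is corrected to 2(m−1), since the printed claim fails there (for L = π there are 2 nonaffine solutions, not 4). *)

(* Defs.v *)
From Stdlib Require Import Reals ZArith Lra.
From Coquelicot Require Import Coquelicot.
Open Scope R_scope.

Definition F (xi : R) : R := (xi ^ 2 - 1) ^ 2.
Definition dF (xi : R) : R := 4 * xi * (xi ^ 2 - 1).

Lemma is_derive_F (xi : R) : is_derive F xi (dF xi).
Proof. unfold F, dF; auto_derive; [easy | ring]. Qed.

Definition closedI (L s : R) : Prop := 0 <= s <= L.

(** [D 0, ..., D n] are the successive derivatives of [Y] on [[0, L]], and
    [Y] is of class C^n on [[0, L]].  [D_in] takes the difference quotients
    inside [[0, L]] only: at [0] and [L] the derivatives are one-sided, and the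
    values of [Y] and of the [D k] off [[0, L]] play no role. *)
Definition Cn_with_derivatives (n : nat) (L : R) (Y : R -> R)
    (D : nat -> R -> R) : Prop :=
  (forall s, closedI L s -> D 0%nat s = Y s) /\
  (forall k s, (k < n)%nat -> closedI L s ->
     D_in (D k) (D (S k)) (closedI L) s) /\
  (forall k s, (k <= n)%nat -> closedI L s -> continue_in (D k) (closedI L) s).

(** The composite differentiated by [Derive] is differentiable at every
    interior point, because [D 1] is. *)
Definition stationary_solution (L : R) (Y : R -> R) : Prop :=
  exists D : nat -> R -> R,
    Cn_with_derivatives 4 L Y D /\
    (forall s, 0 < s < L ->
       D 4%nat s - Derive (fun t => dF (D 1%nat t)) s = 0) /\
    (forall s, s = 0 \/ s = L ->
       dF (D 1%nat s) - D 3%nat s = 0 /\ D 2%nat s = 0).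

Definition eq_up_to_constant (L : R) (Y1 Y2 : R -> R) : Prop :=
  exists c : R, forall s, closedI L s -> Y1 s = Y2 s + c.

Definition affine_on (L : R) (Y : R -> R) : Prop :=
  exists a b : R, forall s, closedI L s -> Y s = a * s + b.

(** Up to additive constants, the solutions are the [2 n + 3] pairwise distinct
    functions [Zf i], [-(n + 1) <= i <= n + 1]: the affine ones for [|i| <= 1]
    and, for [2 <= |i| <= n + 1], exactly [2 n] nonaffine ones, which come in
    opposite pairs. *)
Definition affine_and_exactly_2n_nonaffine_solutions (L : R) (n : Z) : Prop :=
  exists Zf : Z -> R -> R,
    (forall s, Zf 0%Z s = 0) /\
    (forall s, Zf 1%Z s = s) /\
    (forall i s, Zf (- i)%Z s = - Zf i s) /\
    (forall i, (Z.abs i <= n + 1)%Z -> stationary_solution L (Zf i)) /\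
    (forall i, (2 <= Z.abs i <= n + 1)%Z -> ~ affine_on L (Zf i)) /\
    (forall i j, (Z.abs i <= n + 1)%Z -> (Z.abs j <= n + 1)%Z ->
       eq_up_to_constant L (Zf i) (Zf j) -> i = j) /\
    (forall Y, stationary_solution L Y ->
       exists i, (Z.abs i <= n + 1)%Z /\ eq_up_to_constant L Y (Zf i)).

(* Main.v *)
Require Import Defs.
From Stdlib Require Import Reals ZArith Lra Lia Ranalysis5.
From Stdlib Require Import ClassicalEpsilon.
From Coquelicot Require Import Coquelicot.
Open Scope R_scope.

(** The slope [u = Y'] of a stationary solution satisfies [u'' = dF u] with
    [u'(0) = u'(L) = 0]: the equation says that [u'' - dF u] is constant, and
    the boundary condition that this constant is [0].  So the question is how
    many half oscillations of a Duffing oscillator fit exactly into [[0, L]].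

    The energy [u' ^ 2 - 2 F u] is conserved, which forbids [|u(0)| > 1]: then
    [u ^ 2] would stay above [1], and [(u u')' = u' ^ 2 + u dF u > 0] is
    incompatible with [u'] vanishing at both ends
    ([neumann_amplitude_le_1]).  For [a = u(0)] and [p = a ^ 2 <= 1] put
    [u = a cos phi].  Conservation of energy becomes the first-order equation
    [phi' = g_p(phi)], [g_p(x) = sqrt (4 - 2 p (1 + cos x ^ 2))], which for
    [p < 1] has no singularity, unlike [u' = sqrt (2 (F u - F a))] at
    the turning points.  Hence [phi] is the inverse of the elliptic integral
    [travel_time p x] of [/ g_p] from [0] to [x].  By uniqueness for the initial
    value problem ([solves_unique]) these profiles are all the candidates, and
    [a] can be read off from the solution, being its slope at [0].

    The condition [u'(L) = 0] reads [a = 0], or [a ^ 2 = 1], or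
    [phi(L) = k PI] for some [k >= 1], that is [L = k T(a ^ 2)] with the half
    period [T p = travel_time p PI] ([profile_slope_eq_0]).  Now [T] is
    continuous and strictly increasing on [[0, 1)], [T 0 = PI / 2], and [T] is
    unbounded near [1].  So for each [k] with [k PI / 2 < L] there is exactly
    one amplitude [0 < a < 1] with [k T(a ^ 2) = L], and none for the other
    [k].  Counting these [k], each of which gives the pair [a], [- a], yields
    the theorem. *)

(** * Calculus on a closed interval *)

Lemma Derive_of_is_derive (f : R -> R) (x l : R) :
  is_derive f x l -> Derive (fun t : R => f t) x = l.
Proof. exact (is_derive_unique f x l). Qed.

Lemma continuity_pt_of_is_derive (f : R -> R) (x l : R) :
  is_derive f x l -> continuity_pt f x.
Proof.
  intros Hf; apply derivable_continuous_pt.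
  exists l; now apply is_derive_Reals.
Qed.

Lemma D_in_of_is_derive (P : R -> Prop) (f df : R -> R) (s : R) :
  is_derive f s (df s) -> D_in f df P s.
Proof.
  intros H; apply D_in_imp with no_cond; [easy |].
  now apply derivable_pt_lim_D_in, is_derive_Reals.
Qed.

(** At interior points the difference quotients restricted to the interval are
    eventually all difference quotients. *)
Lemma is_derive_interior (L : R) (f df : R -> R) (s : R) :
  D_in f df (closedI L) s -> 0 < s < L -> is_derive f s (df s).
Proof.
  intros Hf Hs.
  apply is_derive_Reals; intros eps Heps.
  destruct (Hf eps Heps) as [alp [Halp H]].
  assert (Hd : 0 < Rmin alp (Rmin s (L - s))) by (repeat apply Rmin_pos; lra).
  exists (mkposreal _ Hd); intros h Hh0 Hh; simpl in Hh.
  assert (H1 := Rmin_l alp (Rmin s (L - s))).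
  assert (H2 := Rmin_r alp (Rmin s (L - s))).
  assert (H3 := Rmin_l s (L - s)).
  assert (H4 := Rmin_r s (L - s)).
  assert (Hb := Rabs_def2 h _ Hh).
  specialize (H (s + h)); simpl in H; unfold Rdist in H.
  replace (s + h - s) with h in H by ring.
  apply H; split; [split; [unfold closedI; lra | lra] | lra].
Qed.

(** Precomposing with [clamp L] turns one-sided continuity at the end points
    into plain continuity, so that the mean value theorem applies to the data of
    a solution, which are only controlled on [[0, L]]. *)
Definition clamp (L s : R) : R := Rmax 0 (Rmin s L).

Lemma clamp_id (L s : R) : 0 <= s <= L -> clamp L s = s.
Proof. intros Hs; unfold clamp; rewrite Rmin_left, Rmax_right; lra. Qed.

Lemma clamp_closedI (L s : R) : 0 < L -> closedI L (clamp L s).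
Proof.
  intros HL; unfold closedI, clamp, Rmax, Rmin.
  repeat destruct Rle_dec; lra.
Qed.

Lemma clamp_contraction (L s t : R) :
  0 < L -> Rabs (clamp L s - clamp L t) <= Rabs (s - t).
Proof.
  intros HL; unfold clamp, Rmax, Rmin.
  repeat destruct Rle_dec; unfold Rabs; repeat destruct Rcase_abs; lra.
Qed.

Lemma continuity_pt_clamp (L : R) (f : R -> R) (s : R) :
  0 < L -> (forall t, closedI L t -> continue_in f (closedI L) t) ->
  continuity_pt (fun t => f (clamp L t)) s.
Proof.
  intros HL Hf eps Heps.
  destruct (Hf (clamp L s) (clamp_closedI L s HL) eps Heps) as [alp [Halp H]].
  exists alp; split; [exact Halp |].
  intros t [_ Ht]; simpl in Ht |- *; unfold Rdist in Ht |- *.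
  destruct (Req_dec (clamp L t) (clamp L s)) as [He | Hne].
  - rewrite He, Rminus_diag, Rabs_R0; lra.
  - apply (H (clamp L t)); split.
    + split; [now apply clamp_closedI | lra].
    + simpl; unfold Rdist.
      generalize (clamp_contraction L t s HL); lra.
Qed.

Lemma is_derive_clamp (L : R) (f : R -> R) (s l : R) :
  0 < s < L -> is_derive f s l -> is_derive (fun t => f (clamp L t)) s l.
Proof.
  intros Hs Hf.
  apply is_derive_ext_loc with f; [| exact Hf].
  assert (Hd : 0 < Rmin s (L - s)) by (apply Rmin_pos; lra).
  exists (mkposreal _ Hd); intros t Ht.
  change (Rabs (t - s) < Rmin s (L - s)) in Ht.
  assert (H1 := Rmin_l s (L - s)).
  assert (H2 := Rmin_r s (L - s)).
  assert (Hb := Rabs_def2 _ _ Ht).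
  rewrite clamp_id; lra.
Qed.

Lemma mean_value (L : R) (f df : R -> R) (s : R) :
  (forall t, 0 <= t <= L -> continuity_pt f t) ->
  (forall t, 0 < t < L -> is_derive f t (df t)) ->
  0 < s <= L -> exists t, 0 < t < s /\ f s - f 0 = df t * s.
Proof.
  intros Hc Hd Hs.
  assert (pr : forall c, 0 < c < s -> derivable_pt f c).
  { intros c Hcs; exists (df c); apply is_derive_Reals, Hd; lra. }
  destruct (MVT f id 0 s pr (fun c _ => derivable_pt_id c)) as [c [Hcs Heq]].
  - lra.
  - intros c Hcs; apply Hc; lra.
  - intros c Hcs; apply derivable_continuous_pt, derivable_pt_id.
  - exists c; split; [exact Hcs |].
    rewrite derive_pt_id in Heq.
    assert (He : derive_pt f c (pr c Hcs) = df c).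
    { apply derive_pt_eq_0, is_derive_Reals, Hd; lra. }
    rewrite He in Heq; unfold id in Heq; lra.
Qed.

Lemma nonincreasing_of_derive (L : R) (f df : R -> R) (s : R) :
  (forall t, 0 <= t <= L -> continuity_pt f t) ->
  (forall t, 0 < t < L -> is_derive f t (df t)) ->
  (forall t, 0 < t < L -> df t <= 0) ->
  0 <= s <= L -> f s <= f 0.
Proof.
  intros Hc Hd Hneg Hs.
  destruct (Req_dec s 0) as [-> | Hs0]; [lra |].
  destruct (mean_value L f df s Hc Hd) as [t [Ht Heq]]; [lra |].
  assert (H := Hneg t ltac:(lra)); nra.
Qed.

Lemma constant_of_derive (L : R) (f : R -> R) (s : R) :
  (forall t, 0 <= t <= L -> continuity_pt f t) ->
  (forall t, 0 < t < L -> is_derive f t 0) ->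
  0 <= s <= L -> f s = f 0.
Proof.
  intros Hc Hd Hs.
  destruct (Req_dec s 0) as [-> | Hs0]; [lra |].
  destruct (mean_value L f (fun _ => 0) s Hc Hd) as [t [Ht Heq]]; lra.
Qed.

(** This reads off derivatives at an end point from values inside the interval
    only. *)
Lemma derive_of_constant_right (f : R -> R) (x y l : R) :
  x < y -> (forall t, x <= t < y -> f t = f x) -> is_derive f x l -> l = 0.
Proof.
  intros Hxy Hf Hl.
  destruct (Req_dec l 0) as [| Hne]; [assumption | exfalso].
  apply is_derive_Reals in Hl.
  destruct (Hl (Rabs l) (Rabs_pos_lt _ Hne)) as [d Hd].
  assert (Hd0 := cond_pos d).
  set (h := Rmin (d / 2) ((y - x) / 2)).
  assert (Hh : 0 < h) by (apply Rmin_pos; lra).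
  assert (H1 := Rmin_l (d / 2) ((y - x) / 2)).
  assert (H2 := Rmin_r (d / 2) ((y - x) / 2)).
  fold h in H1, H2.
  specialize (Hd h ltac:(lra)).
  rewrite (Rabs_pos_eq h) in Hd by lra.
  specialize (Hd ltac:(lra)).
  rewrite (Hf (x + h)) in Hd by lra.
  replace ((f x - f x) / h - l) with (- l) in Hd by (field; lra).
  rewrite Rabs_Ropp in Hd; lra.
Qed.

(** * The second-order equation for the slope *)

Definition solves (L : R) (u v : R -> R) : Prop :=
  (forall s, 0 <= s <= L -> continuity_pt u s /\ continuity_pt v s) /\
  (forall s, 0 < s < L -> is_derive u s (v s) /\ is_derive v s (dF (u s))).

(** [D 3 - dF (D 1)] has zero derivative in the interior and vanishes at [0],
    so the fourth-order problem drops to [u'' = dF u] for [u = D 1], and the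
    boundary conditions on [D 2] become those of Neumann. *)
Lemma stationary_solution_slope (L : R) (Y : R -> R) :
  0 < L -> stationary_solution L Y ->
  exists y u v : R -> R,
    (forall s, 0 <= s <= L -> y s = Y s) /\
    (forall s, 0 <= s <= L -> continuity_pt y s) /\
    (forall s, 0 < s < L -> is_derive y s (u s)) /\
    solves L u v /\ v 0 = 0 /\ v L = 0.
Proof.
  intros HL [D [[HD0 [HD Hcont]] [Heq Hbd]]].
  set (E := fun k s => D k (clamp L s)).
  assert (Ec : forall k s, (k <= 4)%nat -> continuity_pt (E k) s).
  { intros k s Hk; apply continuity_pt_clamp; [exact HL |].
    intros t Ht; now apply Hcont. }
  assert (Eq : forall k s, 0 <= s <= L -> E k s = D k s).
  { intros k s Hs; unfold E; now rewrite clamp_id. }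
  assert (Dd : forall k s, (k < 4)%nat -> 0 < s < L ->
             is_derive (D k) s (D (S k) s)).
  { intros k s Hk Hs; apply (is_derive_interior L); [| exact Hs].
    apply HD; [exact Hk | unfold closedI; lra]. }
  assert (Ed : forall k s, (k < 4)%nat -> 0 < s < L ->
             is_derive (E k) s (E (S k) s)).
  { intros k s Hk Hs; rewrite Eq by lra.
    now apply is_derive_clamp, Dd. }
  assert (Hdf : forall x, is_derive dF x (12 * x ^ 2 - 4)).
  { intros x; unfold dF; auto_derive; [easy | ring]. }
  assert (H3 : forall s, 0 <= s <= L -> E 3%nat s = dF (E 1%nat s)).
  { intros s Hs.
    assert (Hk : E 3%nat s - dF (E 1%nat s) = E 3%nat 0 - dF (E 1%nat 0)).
    { apply (constant_of_derive L (fun t => E 3%nat t - dF (E 1%nat t)));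
        [| | exact Hs].
      - intros t Ht; apply continuity_pt_minus; [apply Ec; lia |].
        apply (continuity_pt_comp (E 1%nat) dF); [apply Ec; lia |].
        eapply continuity_pt_of_is_derive, Hdf.
      - intros t Ht.
        assert (H4 := Heq t Ht).
        rewrite (is_derive_unique _ _ (D 2%nat t * (12 * D 1%nat t ^ 2 - 4)))
          in H4.
        2:{ apply (is_derive_comp dF (D 1%nat)); [apply Hdf |].
            apply Dd; [lia | exact Ht]. }
        replace 0 with (minus (E 4%nat t)
          (scal (E 2%nat t) (12 * E 1%nat t ^ 2 - 4))).
        2:{ rewrite !Eq by lra.
            unfold minus, plus, opp, scal, mult; simpl; unfold mult; simpl.
            simpl in H4; lra. }
        apply (is_derive_minus (E 3%nat) (fun t => dF (E 1%nat t))).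
        + apply Ed; [lia | exact Ht].
        + apply (is_derive_comp dF (E 1%nat)); [apply Hdf |].
          apply Ed; [lia | exact Ht]. }
    destruct (Hbd 0 (or_introl eq_refl)) as [Hb _].
    rewrite !(Eq _ 0) in Hk by lra; lra. }
  exists (E 0%nat), (E 1%nat), (E 2%nat).
  split; [| split; [| split; [| split; [split |]]]].
  - intros s Hs; rewrite Eq by exact Hs; now apply HD0.
  - intros s _; apply Ec; lia.
  - intros s Hs; apply Ed; [lia | exact Hs].
  - intros s _; split; apply Ec; lia.
  - intros s Hs; split; [apply Ed; [lia | exact Hs] |].
    rewrite <- H3 by lra; apply Ed; [lia | exact Hs].
  - rewrite !Eq by lra; split; apply Hbd; auto.
Qed.

(** Gronwall's argument: [dF] is Lipschitz on the bounded range of the two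
    solutions, so the squared distance in the phase plane, multiplied by a
    decaying exponential, cannot increase from its initial value [0]. *)
Lemma solves_unique (L : R) (u1 v1 u2 v2 : R -> R) :
  0 < L -> solves L u1 v1 -> solves L u2 v2 -> u1 0 = u2 0 -> v1 0 = v2 0 ->
  forall s, 0 <= s <= L -> u1 s = u2 s /\ v1 s = v2 s.
Proof.
  intros HL [Hc1 Hd1] [Hc2 Hd2] Hu0 Hv0 s Hs.
  (* [dF (u1 t) - dF (u2 t) = (u1 t - u2 t) * (q t - 1)], so that the squared
     distance [w ^ 2 + z ^ 2] has derivative [2 w z q]. *)
  set (q := fun t => 4 * u1 t ^ 2 + 4 * (u1 t * u2 t) + 4 * u2 t ^ 2 + (-3)).
  assert (Hq : forall t, 0 <= t <= L ->
             continuity_pt (fun t => q t ^ 2) t).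
  { intros t Ht.
    destruct (Hc1 t Ht) as [Ha _]; destruct (Hc2 t Ht) as [Hb _].
    unfold q; reg. }
  destruct (continuity_ab_maj (fun t => q t ^ 2) 0 L ltac:(lra) Hq)
    as [M [HM _]].
  set (C := 1 + q M ^ 2).
  set (w := fun t => u1 t - u2 t); set (z := fun t => v1 t - v2 t).
  set (K := fun t => (w t ^ 2 + z t ^ 2) * exp (- C * t)).
  set (dK := fun t => (2 * w t * z t * q t - C * (w t ^ 2 + z t ^ 2))
                      * exp (- C * t)).
  assert (HK : K s <= K 0).
  { apply (nonincreasing_of_derive L K dK); [| | | exact Hs].
    - intros t Ht.
      destruct (Hc1 t Ht) as [Ha Hb]; destruct (Hc2 t Ht) as [Hc Hd].
      unfold K, w, z; reg.
    - intros t Ht.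
      destruct (Hd1 t Ht) as [Ha Hb]; destruct (Hd2 t Ht) as [Hc Hd].
      unfold K, dK, w, z, q.
      auto_derive.
      + repeat split; eexists; eassumption.
      + rewrite (Derive_of_is_derive _ _ _ Ha), (Derive_of_is_derive _ _ _ Hb),
          (Derive_of_is_derive _ _ _ Hc), (Derive_of_is_derive _ _ _ Hd).
        unfold dF; ring.
    - intros t Ht; unfold dK.
      assert (He := exp_pos (- C * t)).
      assert (Hm := HM t ltac:(lra)); simpl in Hm.
      assert (2 * w t * z t * q t - C * (w t ^ 2 + z t ^ 2) <= 0); [| nra].
      unfold C.
      assert (H1 : 2 * w t * z t * q t <= (1 + q t ^ 2) * (w t ^ 2 + z t ^ 2)).
      { assert (0 <= (w t - q t * z t) ^ 2) by apply pow2_ge_0.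
        assert (0 <= (q t * w t) ^ 2) by apply pow2_ge_0.
        assert (0 <= z t ^ 2) by apply pow2_ge_0.
        nra. }
      assert (0 <= w t ^ 2) by apply pow2_ge_0.
      assert (0 <= z t ^ 2) by apply pow2_ge_0.
      simpl in *; nra. }
  assert (H0 : K 0 = 0) by (unfold K, w, z; rewrite Hu0, Hv0; ring).
  rewrite H0 in HK; unfold K in HK.
  assert (He := exp_pos (- C * s)).
  assert (H1 : 0 <= w s ^ 2) by apply pow2_ge_0.
  assert (H2 : 0 <= z s ^ 2) by apply pow2_ge_0.
  assert (H3 : w s ^ 2 = 0) by nra.
  assert (H4 : z s ^ 2 = 0) by nra.
  unfold w, z in H3, H4.
  split; apply Rminus_diag_uniq; nra.
Qed.

Lemma solves_energy (L : R) (u v : R -> R) (s : R) :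
  solves L u v -> 0 <= s <= L ->
  v s ^ 2 - 2 * F (u s) = v 0 ^ 2 - 2 * F (u 0).
Proof.
  intros [Hc Hd] Hs.
  apply (constant_of_derive L (fun t => v t ^ 2 - 2 * F (u t))); [| | exact Hs].
  - intros t Ht; destruct (Hc t Ht) as [Hu Hv]; unfold F; reg.
  - intros t Ht; destruct (Hd t Ht) as [Hu Hv]; unfold F.
    auto_derive.
    + repeat split; eexists; eassumption.
    + rewrite (Derive_of_is_derive _ _ _ Hu), (Derive_of_is_derive _ _ _ Hv).
      unfold dF; ring.
Qed.

(** If [u ^ 2 > 1] at [0], then it stays so: where [u ^ 2] reached [1], [F u]
    would be [0], and the energy [- 2 F (u 0) < 0] would equal [v ^ 2 >= 0].
    But then [u v], which vanishes at both ends, has a positive derivative. *)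
Lemma neumann_amplitude_le_1 (L : R) (u v : R -> R) :
  0 < L -> solves L u v -> v 0 = 0 -> v L = 0 -> -1 <= u 0 <= 1.
Proof.
  intros HL Hsol Hv0 HvL.
  assert (Hnn : ~ 1 < u 0 ^ 2); [| split; nra].
  intros Ha.
  assert (Hu : forall s, 0 <= s <= L -> 1 < u s ^ 2).
  { intros s Hs.
    destruct (Rlt_or_le 1 (u s ^ 2)) as [| Hle]; [assumption | exfalso].
    destruct Hsol as [Hc Hd].
    assert (Hs0 : 0 < s) by (destruct (Req_dec s 0) as [-> |]; lra).
    assert (Hi : exists t, 0 <= t <= s /\ u t ^ 2 = 1).
    { destruct (Req_dec (u s ^ 2) 1) as [He | Hne]; [exists s; lra |].
      destruct (IVT_interv (fun t => 1 - u t ^ 2) 0 s) as [t [Ht H1]]; try lra.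
      - intros t Ht; destruct (Hc t ltac:(lra)) as [Hu _]; reg.
      - exists t; split; lra. }
    destruct Hi as [t [Ht H1]].
    assert (He := solves_energy L u v t (conj Hc Hd) ltac:(lra)).
    rewrite Hv0 in He; unfold F in He; rewrite H1 in He.
    assert (0 <= v t ^ 2) by apply pow2_ge_0.
    assert (0 < (u 0 ^ 2 - 1) ^ 2) by (apply pow2_gt_0; lra).
    nra. }
  destruct Hsol as [Hc Hd].
  destruct (mean_value L (fun t => u t * v t)
              (fun t => v t ^ 2 + u t * dF (u t)) L) as [t [Ht H]].
  - intros t Ht; destruct (Hc t Ht) as [Hcu Hcv]; reg.
  - intros t Ht; destruct (Hd t Ht) as [Hdu Hdv].
    auto_derive.
    + repeat split; eexists; eassumption.
    + rewrite (Derive_of_is_derive _ _ _ Hdu), (Derive_of_is_derive _ _ _ Hdv).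
      ring.
  - lra.
  - rewrite Hv0, HvL in H; unfold dF in H.
    assert (H1 := Hu t ltac:(lra)).
    assert (0 <= v t ^ 2) by apply pow2_ge_0.
    assert (0 < u t ^ 2 * (u t ^ 2 - 1)) by (apply Rmult_lt_0_compat; lra).
    nra.
Qed.

(** * Inverting a function whose derivative is bounded below *)

(** The bound [g <= M] makes [G] grow at least linearly. *)
Lemma inverse_surjective (G g : R -> R) (M : R) :
  G 0 = 0 -> (forall x, is_derive G x (/ g x)) -> (forall x, 0 < g x <= M) ->
  forall s, {x : R | G x = s}.
Proof.
  intros HG0 HG Hg s.
  assert (HM : 0 < M) by (generalize (Hg 0); lra).
  assert (Hgrow : forall x, Rabs x <= M * Rabs (G x) /\ 0 <= x * G x).
  { intros x.
    destruct (MVT_gen G 0 x (fun y => / g y)) as [c [_ Hc]].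
    - intros; apply HG.
    - intros y _; eapply continuity_pt_of_is_derive, HG.
    - rewrite HG0 in Hc; destruct (Hg c) as [Hc0 HcM].
      assert (Hx : x = g c * G x).
      { replace (G x) with (/ g c * x) by lra; field; lra. }
      split.
      + rewrite Hx at 1; rewrite Rabs_mult, (Rabs_pos_eq (g c)) by lra.
        apply Rmult_le_compat_r; [apply Rabs_pos | exact HcM].
      + rewrite Hx at 1; nra. }
  assert (Hs := Rabs_pos s).
  set (b := M * (Rabs s + 1)).
  assert (Hb : 0 < b) by (unfold b; nra).
  assert (Hup : Rabs s <= G b).
  { destruct (Hgrow b) as [H1 H2].
    assert (HGb : 0 <= G b) by nra.
    rewrite (Rabs_pos_eq b), (Rabs_pos_eq (G b)) in H1 by lra.
    unfold b at 1 in H1; nra. }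
  assert (Hlo : G (- b) <= - Rabs s).
  { destruct (Hgrow (- b)) as [H1 H2].
    assert (HGb : G (- b) <= 0) by nra.
    rewrite (Rabs_left1 (- b)), (Rabs_left1 (G (- b))) in H1 by lra.
    unfold b at 1 in H1; nra. }
  destruct (IVT_gen G (- b) b s) as [x [_ Hx]].
  - intros x; eapply continuity_pt_of_is_derive, HG.
  - assert (- Rabs s <= s <= Rabs s)
      by (unfold Rabs; destruct Rcase_abs; lra).
    rewrite Rmin_left, Rmax_right; lra.
  - now exists x.
Qed.

(** By the mean value theorem the difference quotient of [f] equals [g c] for
    some [c] between [f s] and [f (s + h)]; the bound [g <= M] makes [f]
    Lipschitz, which forces [c] to tend to [f s]. *)
Lemma is_derive_right_inverse (G g f : R -> R) (M : R) :
  (forall x, is_derive G x (/ g x)) -> (forall x, 0 < g x <= M) ->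
  (forall x, continuity_pt g x) -> (forall s, G (f s) = s) ->
  forall s, is_derive f s (g (f s)).
Proof.
  intros HG Hg Hcont Hf s.
  assert (HM : 0 < M) by (generalize (Hg 0); lra).
  apply is_derive_Reals; intros eps Heps.
  destruct (Hcont (f s) eps Heps) as [alp [Halp Hc]].
  assert (Hd : 0 < alp / M) by (apply Rdiv_lt_0_compat; lra).
  exists (mkposreal _ Hd); intros h Hh Hhd; simpl in Hhd.
  destruct (MVT_gen G (f s) (f (s + h)) (fun y => / g y)) as [c [Hcb Hmv]].
  - intros; apply HG.
  - intros y _; eapply continuity_pt_of_is_derive, HG.
  - rewrite !Hf in Hmv; destruct (Hg c) as [Hc0 HcM].
    assert (Heq : f (s + h) - f s = g c * h).
    { replace h with (/ g c * (f (s + h) - f s)) at 2 by lra; field; lra. }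
    replace ((f (s + h) - f s) / h) with (g c) by (rewrite Heq; field; lra).
    destruct (Req_dec c (f s)) as [-> | Hne].
    { rewrite Rminus_diag, Rabs_R0; exact Heps. }
    apply (Hc c); split; [split; [exact I | lra] |].
    simpl; unfold Rdist.
    assert (H1 : Rabs (c - f s) <= Rabs (f (s + h) - f s)).
    { revert Hcb; unfold Rmin, Rmax; destruct Rle_dec; intros Hcb;
        unfold Rabs; repeat destruct Rcase_abs; lra. }
    rewrite Heq, Rabs_mult, (Rabs_pos_eq (g c)) in H1 by lra.
    apply Rle_lt_trans with (1 := H1).
    apply Rle_lt_trans with (M * Rabs h).
    + apply Rmult_le_compat_r; [apply Rabs_pos | exact HcM].
    + apply (Rmult_lt_compat_l M) in Hhd; [| exact HM].
      replace (M * (alp / M)) with alp in Hhd by (field; lra); exact Hhd.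
Qed.

Lemma increasing_of_derive_pos (G dG : R -> R) (x y : R) :
  (forall t, is_derive G t (dG t)) -> (forall t, 0 < dG t) ->
  x < y -> G x < G y.
Proof.
  intros HG HdG Hxy.
  apply (incr_function G m_infty p_infty dG); simpl; auto.
  intros t _ _; apply HdG.
Qed.

Lemma injective_of_derive_pos (G dG : R -> R) (x y : R) :
  (forall t, is_derive G t (dG t)) -> (forall t, 0 < dG t) ->
  G x = G y -> x = y.
Proof.
  intros HG HdG Heq.
  destruct (Rtotal_order x y) as [H | [H | H]]; [| exact H |];
    apply (increasing_of_derive_pos G dG) in H; auto; lra.
Qed.

(** * The phase equation and its half period *)

(** Substituting [u = a cos phi] in [u' ^ 2 = 2 (F u - F a)], the factor
    [a ^ 2 sin phi ^ 2] cancels and leaves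
    [phi' ^ 2 = phase_speed2 (a ^ 2) phi]. *)
Definition phase_speed2 (p x : R) : R := 4 - 2 * p * (1 + cos x ^ 2).
Definition phase_speed (p x : R) : R := sqrt (phase_speed2 p x).
Definition travel_time (p x : R) : R :=
  RInt (fun t => / phase_speed p t) 0 x.
Definition half_period (p : R) : R := travel_time p PI.

Lemma cos2_bounds (x : R) : 0 <= cos x ^ 2 <= 1.
Proof. generalize (COS_bound x); intros; split; nra. Qed.

Lemma phase_speed2_pos (p x : R) : p < 1 -> 0 < phase_speed2 p x.
Proof. intros Hp; unfold phase_speed2; generalize (cos2_bounds x); nra. Qed.

Lemma phase_speed_pos (p x : R) : p < 1 -> 0 < phase_speed p x.
Proof. intros Hp; now apply sqrt_lt_R0, phase_speed2_pos. Qed.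

Lemma phase_speed_sqr (p x : R) :
  p < 1 -> phase_speed p x ^ 2 = phase_speed2 p x.
Proof. intros Hp; apply pow2_sqrt, Rlt_le, phase_speed2_pos, Hp. Qed.

Lemma phase_speed_le (p x : R) :
  p < 1 -> phase_speed p x <= 4 + 4 * Rabs p.
Proof.
  intros Hp.
  assert (Ha := Rabs_pos p).
  assert (Hb : - Rabs p <= p) by (unfold Rabs; destruct Rcase_abs; lra).
  assert (Hc := cos2_bounds x).
  assert (Hs := phase_speed_sqr p x Hp).
  assert (Hpos := phase_speed_pos p x Hp).
  unfold phase_speed2 in Hs; nra.
Qed.

Lemma is_derive_phase_speed (p x : R) :
  p < 1 -> is_derive (phase_speed p) x
             (2 * p * cos x * sin x / phase_speed p x).
Proof.
  intros Hp.
  assert (H1 := phase_speed2_pos p x Hp).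
  assert (H2 := phase_speed_pos p x Hp).
  replace (2 * p * cos x * sin x / phase_speed p x)
    with (4 * p * cos x * sin x / (2 * phase_speed p x)) by (field; lra).
  apply (is_derive_sqrt (phase_speed2 p)); [| exact H1].
  unfold phase_speed2; auto_derive; [easy | ring].
Qed.

Lemma continuous_inv_phase_speed (p x : R) :
  p < 1 -> continuous (fun t => / phase_speed p t) x.
Proof.
  intros Hp; apply continuity_pt_filterlim, continuity_pt_inv.
  - eapply continuity_pt_of_is_derive, is_derive_phase_speed, Hp.
  - generalize (phase_speed_pos p x Hp); lra.
Qed.

Lemma ex_RInt_inv_phase_speed (p a b : R) :
  p < 1 -> ex_RInt (fun t => / phase_speed p t) a b.
Proof.
  intros Hp; apply (ex_RInt_continuous (V := R_CompleteNormedModule)).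
  intros; now apply continuous_inv_phase_speed.
Qed.

Lemma is_derive_travel_time (p x : R) :
  p < 1 -> is_derive (travel_time p) x (/ phase_speed p x).
Proof.
  intros Hp.
  apply (is_derive_RInt (fun t => / phase_speed p t) (travel_time p) 0).
  - apply filter_forall; intros y.
    apply (RInt_correct (V := R_CompleteNormedModule)).
    now apply ex_RInt_inv_phase_speed.
  - now apply continuous_inv_phase_speed.
Qed.

Lemma travel_time_0 (p : R) : travel_time p 0 = 0.
Proof. apply (RInt_point (V := R_CompleteNormedModule)). Qed.

Lemma travel_time_lt (p x y : R) :
  p < 1 -> x < y -> travel_time p x < travel_time p y.
Proof.
  intros Hp; apply increasing_of_derive_pos with (fun t => / phase_speed p t).
  - intros t; now apply is_derive_travel_time.
  - intros t; now apply Rinv_0_lt_compat, phase_speed_pos.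
Qed.

Lemma travel_time_inj (p x y : R) :
  p < 1 -> travel_time p x = travel_time p y -> x = y.
Proof.
  intros Hp; apply injective_of_derive_pos with (fun t => / phase_speed p t).
  - intros t; now apply is_derive_travel_time.
  - intros t; now apply Rinv_0_lt_compat, phase_speed_pos.
Qed.

Lemma travel_time_surj (p : R) (Hp : p < 1) (s : R) :
  {x : R | travel_time p x = s}.
Proof.
  apply inverse_surjective
    with (g := phase_speed p) (M := 4 + 4 * Rabs p).
  - apply travel_time_0.
  - intros x; now apply is_derive_travel_time.
  - intros x; split; [now apply phase_speed_pos | now apply phase_speed_le].
Qed.

(** [phase_speed p] has period [PI], since it depends on [cos ^ 2] only. *)
Lemma travel_time_mult_PI (p : R) (n : nat) :
  p < 1 -> travel_time p (INR n * PI) = INR n * half_period p.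
Proof.
  intros Hp; induction n as [| n IH].
  - simpl; rewrite !Rmult_0_l; apply travel_time_0.
  - rewrite S_INR, !Rmult_plus_distr_r, !Rmult_1_l, <- IH.
    assert (HPI := PI_RGT_0); assert (Hn := pos_INR n).
    assert (Hd : forall t,
      is_derive (fun t => travel_time p (t + PI) - travel_time p t) t 0).
    { intros t.
      replace 0 with (minus (scal 1 (/ phase_speed p (t + PI)))
                            (/ phase_speed p t)).
      - apply (is_derive_minus (fun t => travel_time p (t + PI))).
        + apply (is_derive_comp (travel_time p) (fun t => t + PI)).
          * now apply is_derive_travel_time.
          * auto_derive; [easy | ring].
        + now apply is_derive_travel_time.
      - unfold phase_speed, phase_speed2; rewrite neg_cos.
        replace ((- cos t) ^ 2) with (cos t ^ 2) by ring.
        unfold minus, plus, opp, scal; simpl; unfold mult; simpl; ring. }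
    assert (H := constant_of_derive (INR n * PI)
      (fun t => travel_time p (t + PI) - travel_time p t) (INR n * PI)
      (fun t _ => continuity_pt_of_is_derive _ t 0 (Hd t))
      (fun t _ => Hd t) ltac:(nra)).
    simpl in H; rewrite Rplus_0_l, travel_time_0 in H.
    unfold half_period; lra.
Qed.

(** A larger amplitude slows the phase down everywhere. *)
Lemma half_period_lt (p q : R) : p < q < 1 -> half_period p < half_period q.
Proof.
  intros Hpq; apply RInt_lt.
  - apply PI_RGT_0.
  - intros; apply continuous_inv_phase_speed; lra.
  - intros; apply continuous_inv_phase_speed; lra.
  - intros x _; apply Rinv_lt_contravar.
    + apply Rmult_lt_0_compat; apply phase_speed_pos; lra.
    + apply sqrt_lt_1_alt; split.
      * apply Rlt_le, phase_speed2_pos; lra.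
      * unfold phase_speed2; generalize (cos2_bounds x); nra.
Qed.

(** This is the half period [PI / 2] of the linearization [u'' = - 4 u]. *)
Lemma half_period_0 : half_period 0 = PI / 2.
Proof.
  unfold half_period, travel_time.
  rewrite (RInt_ext _ (fun _ => / 2)).
  - rewrite RInt_const; unfold scal; simpl; unfold mult; simpl; field.
  - intros x _; unfold phase_speed, phase_speed2.
    replace (4 - 2 * 0 * (1 + cos x ^ 2)) with (2 * 2) by ring.
    now rewrite sqrt_square by lra.
Qed.

Lemma half_period_gt (p : R) : 0 < p < 1 -> PI / 2 < half_period p.
Proof. intros Hp; rewrite <- half_period_0; now apply half_period_lt. Qed.

Lemma half_period_sqr_inj (a b : R) :
  0 < a < 1 -> 0 < b < 1 ->
  half_period (a ^ 2) = half_period (b ^ 2) -> a = b.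
Proof.
  intros Ha Hb H.
  destruct (Rtotal_order (a ^ 2) (b ^ 2)) as [Hlt | [Heq | Hlt]].
  - generalize (half_period_lt (a ^ 2) (b ^ 2)); nra.
  - nra.
  - generalize (half_period_lt (b ^ 2) (a ^ 2)); nra.
Qed.

(** For [p <= q < 1] the squared speed is at least [4 (1 - q)], so its inverse
    square root is Lipschitz in [p], uniformly in [x]. *)
Lemma inv_phase_speed_lipschitz (q p p' x : R) :
  q < 1 -> p <= q -> p' <= q -> 0 <= q ->
  Rabs (/ phase_speed p x - / phase_speed p' x)
    <= 4 / (2 * sqrt (4 * (1 - q)) ^ 3) * Rabs (p - p').
Proof.
  intros Hq Hp Hp' Hq0.
  set (d := sqrt (4 * (1 - q))).
  assert (Hd : 0 < d) by (apply sqrt_lt_R0; lra).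
  assert (Hc := cos2_bounds x).
  assert (Hlow : forall r, r <= q -> d <= phase_speed r x).
  { intros r Hr; apply sqrt_le_1_alt; unfold phase_speed2; nra. }
  assert (Ha := Hlow p Hp); assert (Hb := Hlow p' Hp').
  assert (Ha2 := phase_speed_sqr p x ltac:(lra)).
  assert (Hb2 := phase_speed_sqr p' x ltac:(lra)).
  set (a := phase_speed p x) in *; set (b := phase_speed p' x) in *.
  assert (Heq : / a - / b =
    2 * (1 + cos x ^ 2) * (p - p') * / (a * b * (a + b))).
  { replace (2 * (1 + cos x ^ 2) * (p - p')) with (b ^ 2 - a ^ 2)
      by (rewrite Ha2, Hb2; unfold phase_speed2; ring).
    field; repeat split; nra. }
  assert (Hden : 2 * d ^ 3 <= a * b * (a + b)).
  { assert (d * d <= a * b) by nra.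
    assert (d * d * (2 * d) <= a * b * (a + b)); [| nra].
    apply Rmult_le_compat; nra. }
  assert (Hd3 : 0 < 2 * d ^ 3).
  { apply Rmult_lt_0_compat; [lra | now apply pow_lt]. }
  rewrite Heq, !Rabs_mult.
  rewrite (Rabs_pos_eq 2), (Rabs_pos_eq (1 + cos x ^ 2)) by lra.
  rewrite (Rabs_pos_eq (/ _)) by (apply Rlt_le, Rinv_0_lt_compat; lra).
  assert (Hi : / (a * b * (a + b)) <= / (2 * d ^ 3))
    by (apply Rinv_le_contravar; lra).
  assert (Hi0 : 0 < / (a * b * (a + b))) by (apply Rinv_0_lt_compat; lra).
  unfold Rdiv.
  replace (4 * / (2 * d ^ 3) * Rabs (p - p'))
    with (4 * Rabs (p - p') * / (2 * d ^ 3)) by ring.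
  assert (Hr := Rabs_pos (p - p')).
  apply Rmult_le_compat; nra.
Qed.

Lemma half_period_continuous (p : R) : p < 1 -> continuity_pt half_period p.
Proof.
  intros Hp.
  set (q := (1 + Rmax p 0) / 2).
  assert (Hm1 := Rmax_l p 0); assert (Hm2 := Rmax_r p 0).
  assert (Hm3 : Rmax p 0 < 1) by (apply Rmax_lub_lt; lra).
  assert (Hq : p < q /\ 0 <= q < 1) by (unfold q; lra).
  set (K := 4 / (2 * sqrt (4 * (1 - q)) ^ 3)).
  assert (HK : 0 < K).
  { apply Rdiv_lt_0_compat; [lra |].
    apply Rmult_lt_0_compat; [lra |].
    apply pow_lt, sqrt_lt_R0; lra. }
  assert (HPI := PI_RGT_0).
  intros eps Heps.
  exists (Rmin (q - p) (eps / (PI * K))).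
  assert (Heps' : 0 < eps / (PI * K))
    by (apply Rdiv_lt_0_compat; [lra | now apply Rmult_lt_0_compat]).
  split; [apply Rmin_pos; lra |].
  intros r [_ Hr]; simpl in Hr |- *; unfold Rdist in *.
  assert (H1 := Rmin_l (q - p) (eps / (PI * K))).
  assert (H2 := Rmin_r (q - p) (eps / (PI * K))).
  assert (Hrq : r < q).
  { assert (H := Rle_abs (r - p)); lra. }
  unfold half_period, travel_time.
  change (Rabs (minus (RInt (fun t => / phase_speed r t) 0 PI)
                      (RInt (fun t => / phase_speed p t) 0 PI)) < eps).
  rewrite <- (RInt_minus (V := R_CompleteNormedModule))
    by (apply ex_RInt_inv_phase_speed; lra).
  apply Rle_lt_trans with ((PI - 0) * (K * Rabs (r - p))).
  - apply abs_RInt_le_const; [lra | |].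
    + apply (ex_RInt_minus (V := R_NormedModule));
        apply ex_RInt_inv_phase_speed; lra.
    + intros t _; apply inv_phase_speed_lipschitz; lra.
  - apply Rlt_le_trans with (PI * K * (eps / (PI * K))).
    + rewrite Rminus_0_r, <- Rmult_assoc; apply Rmult_lt_compat_l; nra.
    + right; field; lra.
Qed.

(** As [p] tends to [1] the phase lingers near its rest point [0].  With
    [p = 1 - e ^ 2] one has [phase_speed2 p x <= 4 e ^ 2 + 2 x ^ 2], whence
    [phase_speed p x <= 2 (e + x)] and
    [half_period p >= ln ((e + PI) / e) / 2]. *)
Lemma half_period_unbounded (M : R) :
  0 < M -> exists p, 0 < p < 1 /\ M <= half_period p.
Proof.
  intros HM.
  (* Chosen so that [- ln e / 2 = M]; the remaining [ln (e + PI) / 2] is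
     positive. *)
  set (e := exp (- (2 * M))).
  assert (He0 : 0 < e) by apply exp_pos.
  assert (He1 : e < 1).
  { unfold e; rewrite <- exp_0; apply exp_increasing; lra. }
  exists (1 - e ^ 2).
  split; [nra |].
  assert (HPI := PI2_3_2).
  assert (Hd : forall x, 0 <= x -> is_derive (fun x => ln (e + x) / 2) x
                                             (/ (2 * (e + x)))).
  { intros x Hx; auto_derive; [lra | field; lra]. }
  assert (Hc : forall x, 0 <= x -> continuous (fun x => / (2 * (e + x))) x).
  { intros x Hx; apply (ex_derive_continuous (V := R_NormedModule)).
    auto_derive; lra. }
  assert (Hint : is_RInt (fun x => / (2 * (e + x))) 0 PI
                         (ln (e + PI) / 2 - ln (e + 0) / 2)).
  { apply (is_RInt_derive (V := R_CompleteNormedModule)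
             (fun x => ln (e + x) / 2)).
    - intros x Hx; rewrite Rmin_left, Rmax_right in Hx by lra; apply Hd; lra.
    - intros x Hx; rewrite Rmin_left, Rmax_right in Hx by lra; apply Hc; lra. }
  apply Rle_trans with (RInt (fun x => / (2 * (e + x))) 0 PI).
  - rewrite (is_RInt_unique _ _ _ _ Hint), Rplus_0_r.
    unfold e at 2; rewrite ln_exp.
    assert (0 < ln (e + PI)).
    { rewrite <- ln_1; apply ln_increasing; lra. }
    lra.
  - apply RInt_le; [lra | now eexists; apply Hint | |].
    + apply ex_RInt_inv_phase_speed; nra.
    + intros x Hx.
      assert (Hp : 1 - e ^ 2 < 1) by nra.
      apply Rinv_le_contravar; [now apply phase_speed_pos |].
      assert (H1 := phase_speed_sqr (1 - e ^ 2) x Hp).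
      assert (H2 := phase_speed_pos (1 - e ^ 2) x Hp).
      unfold phase_speed2 in H1.
      assert (Hsin : sin x ^ 2 <= x ^ 2).
      { assert (sin x < x) by (apply sin_lt_x; lra).
        assert (0 < sin x) by (apply sin_gt_0; lra).
        nra. }
      assert (Hcs := sin2_cos2 x); unfold Rsqr in Hcs.
      nra.
Qed.

(** * The profiles of given amplitude *)

(** The solution of [phi' = phase_speed p phi], [phi 0 = 0].  At [p = 1] the
    initial value is a rest point, whence the value [0] there; this lets the
    profiles below include the constants [1] and [- 1]. *)
Definition phase (p s : R) : R :=
  match Rlt_dec p 1 with
  | left Hp => proj1_sig (travel_time_surj p Hp s)
  | right _ => 0
  end.

Lemma travel_time_phase (p s : R) : p < 1 -> travel_time p (phase p s) = s.
Proof.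
  intros Hp; unfold phase; destruct (Rlt_dec p 1) as [H | H]; [| lra].
  apply proj2_sig.
Qed.

Lemma phase_ge_1 (p s : R) : 1 <= p -> phase p s = 0.
Proof.
  intros Hp; unfold phase; destruct (Rlt_dec p 1); [exfalso; lra | easy].
Qed.

Lemma phase_0 (p : R) : phase p 0 = 0.
Proof.
  destruct (Rlt_or_le p 1) as [Hp | Hp]; [| now apply phase_ge_1].
  apply (travel_time_inj p); [exact Hp |].
  now rewrite travel_time_phase, travel_time_0.
Qed.

Lemma is_derive_phase (p s : R) :
  p < 1 -> is_derive (phase p) s (phase_speed p (phase p s)).
Proof.
  intros Hp; revert s.
  apply (is_derive_right_inverse (travel_time p)) with (4 + 4 * Rabs p).
  - intros x; now apply is_derive_travel_time.
  - intros x; split; [now apply phase_speed_pos | now apply phase_speed_le].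
  - intros x; eapply continuity_pt_of_is_derive, is_derive_phase_speed, Hp.
  - intros s; now apply travel_time_phase.
Qed.

Lemma phase_eq_mult_PI (p s : R) (k : Z) :
  p < 1 -> (0 <= k)%Z ->
  phase p s = IZR k * PI <-> IZR k * half_period p = s.
Proof.
  intros Hp Hk.
  assert (H : travel_time p (IZR k * PI) = IZR k * half_period p).
  { rewrite <- (Z2Nat.id k Hk), <- INR_IZR_INZ.
    now apply travel_time_mult_PI. }
  rewrite <- H; split; intros Heq.
  - rewrite <- Heq; now apply travel_time_phase.
  - apply (travel_time_inj p); [exact Hp |].
    now rewrite travel_time_phase.
Qed.

Lemma phase_pos (p s : R) : p < 1 -> 0 < s -> 0 < phase p s.
Proof.
  intros Hp Hs.
  destruct (Rtotal_order 0 (phase p s)) as [H | [H | H]]; [exact H | |].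
  - rewrite <- (travel_time_phase p s Hp), <- H, travel_time_0 in Hs; lra.
  - apply (travel_time_lt p _ _ Hp) in H.
    rewrite travel_time_phase, travel_time_0 in H; lra.
Qed.

Definition profile (a s : R) : R := a * cos (phase (a ^ 2) s).
Definition profile_slope (a s : R) : R :=
  - a * sin (phase (a ^ 2) s) * phase_speed (a ^ 2) (phase (a ^ 2) s).
Definition profile_primitive (a s : R) : R :=
  a * RInt (fun t => cos (phase (a ^ 2) t)) 0 s.

Lemma profile_0 (a : R) : profile a 0 = a.
Proof. unfold profile; rewrite phase_0, cos_0; ring. Qed.

Lemma profile_slope_0 (a : R) : profile_slope a 0 = 0.
Proof. unfold profile_slope; rewrite phase_0, sin_0; ring. Qed.

Lemma profile_1 (a s : R) : a ^ 2 = 1 -> profile a s = a.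
Proof. intros Ha; unfold profile; rewrite phase_ge_1, cos_0; lra. Qed.

Lemma profile_slope_1 (a s : R) : a ^ 2 = 1 -> profile_slope a s = 0.
Proof. intros Ha; unfold profile_slope; rewrite phase_ge_1, sin_0; lra. Qed.

Lemma dF_eq_0 (a : R) : dF a = 0 <-> a = 0 \/ a ^ 2 = 1.
Proof.
  unfold dF; split.
  - intros H; destruct (Req_dec a 0) as [| Ha]; [now left | right].
    apply Rmult_integral in H; destruct H as [H | H]; lra.
  - intros [-> | ->]; ring.
Qed.

Lemma is_derive_profile (a s : R) :
  a ^ 2 <= 1 -> is_derive (profile a) s (profile_slope a s).
Proof.
  intros [Ha | Ha].
  - assert (Hp := is_derive_phase (a ^ 2) s Ha).
    unfold profile, profile_slope; remember (a ^ 2) as p; auto_derive.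
    + eexists; exact Hp.
    + rewrite (Derive_of_is_derive _ _ _ Hp); ring.
  - rewrite profile_slope_1 by exact Ha.
    apply is_derive_ext with (fun _ => a).
    + intros t; now rewrite profile_1.
    + apply (is_derive_const (V := R_NormedModule)).
Qed.

(** For [a ^ 2 < 1] this is the computation
    [(- a sin phi g)' = - a cos phi g ^ 2 - a sin phi (g g')], in which
    [g ^ 2] and [g g' = 2 p cos phi sin phi] are polynomial in [cos phi] and
    [sin phi].  For [a ^ 2 = 1], where [g] need not be differentiable, the
    profile is constant. *)
Lemma is_derive_profile_slope (a s : R) :
  a ^ 2 <= 1 -> is_derive (profile_slope a) s (dF (profile a s)).
Proof.
  intros [Ha | Ha].
  - assert (Hp := is_derive_phase (a ^ 2) s Ha).
    assert (Hg := is_derive_phase_speed (a ^ 2) (phase (a ^ 2) s) Ha).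
    assert (H2 := phase_speed_sqr (a ^ 2) (phase (a ^ 2) s) Ha).
    assert (H0 := phase_speed_pos (a ^ 2) (phase (a ^ 2) s) Ha).
    unfold profile, profile_slope; remember (a ^ 2) as p eqn:Hpa.
    auto_derive.
    + repeat split; eexists; eassumption.
    + rewrite (Derive_of_is_derive _ _ _ Hp), (Derive_of_is_derive _ _ _ Hg).
      set (x := phase p s) in *; set (g := phase_speed p x) in *.
      unfold phase_speed2 in H2.
      assert (Hs := sin2_cos2 x); unfold Rsqr in Hs.
      replace (dF (a * cos x))
        with (- a * cos x * (4 - 2 * p * (1 + cos x ^ 2))
              - a * (sin x * sin x) * (2 * p * cos x)).
      2:{ replace (sin x * sin x) with (1 - cos x * cos x) by lra.
          rewrite Hpa; unfold dF; ring. }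
      rewrite <- H2; field; lra.
  - apply is_derive_ext with (fun _ => 0).
    + intros t; now rewrite profile_slope_1.
    + rewrite profile_1 by exact Ha.
      replace (dF a) with 0 by (symmetry; apply dF_eq_0; now right).
      apply (is_derive_const (V := R_NormedModule)).
Qed.

Lemma continuous_cos_phase (p s : R) : continuous (fun t => cos (phase p t)) s.
Proof.
  apply continuity_pt_filterlim.
  destruct (Rlt_or_le p 1) as [Hp | Hp].
  - apply (continuity_pt_comp (phase p) cos); [| apply continuity_cos].
    eapply continuity_pt_of_is_derive, is_derive_phase, Hp.
  - apply continuity_pt_ext with (fun _ => cos 0).
    + intros t; now rewrite phase_ge_1.
    + apply continuity_pt_const; intros ? ?; reflexivity.
Qed.

Lemma is_derive_profile_primitive (a s : R) :
  is_derive (profile_primitive a) s (profile a s).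
Proof.
  apply (is_derive_scal (fun t => RInt (fun t => cos (phase (a ^ 2) t)) 0 t)).
  apply (is_derive_RInt (fun t => cos (phase (a ^ 2) t)) _ 0).
  - apply filter_forall; intros y.
    apply (RInt_correct (V := R_CompleteNormedModule)).
    apply (ex_RInt_continuous (V := R_CompleteNormedModule)).
    intros; apply continuous_cos_phase.
  - apply continuous_cos_phase.
Qed.

Lemma profile_primitive_opp (a s : R) :
  profile_primitive (- a) s = - profile_primitive a s.
Proof.
  unfold profile_primitive; replace ((- a) ^ 2) with (a ^ 2) by ring; ring.
Qed.

Lemma profile_primitive_0 (s : R) : profile_primitive 0 s = 0.
Proof. unfold profile_primitive; ring. Qed.

Lemma profile_primitive_1 (s : R) : profile_primitive 1 s = s.
Proof.
  unfold profile_primitive.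
  rewrite (RInt_ext _ (fun _ => 1)).
  - rewrite RInt_const; unfold scal; simpl; unfold mult; simpl; ring.
  - intros t _; rewrite phase_ge_1; [apply cos_0 | lra].
Qed.

Lemma solves_profile (L a : R) :
  a ^ 2 <= 1 -> solves L (profile a) (profile_slope a).
Proof.
  intros Ha; split; intros s _; split.
  - eapply continuity_pt_of_is_derive, is_derive_profile, Ha.
  - eapply continuity_pt_of_is_derive, is_derive_profile_slope, Ha.
  - now apply is_derive_profile.
  - now apply is_derive_profile_slope.
Qed.

(** * Stationary solutions are the resonant profiles *)

Lemma stationary_profile_primitive (L a c : R) (Y : R -> R) :
  a ^ 2 <= 1 -> profile_slope a L = 0 ->
  (forall s, closedI L s -> Y s = profile_primitive a s + c) ->
  stationary_solution L Y.
Proof.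
  intros Ha HL HY.
  set (D := fun k : nat => match k with
    | 0%nat => fun s => profile_primitive a s + c
    | 1%nat => profile a
    | 2%nat => profile_slope a
    | 3%nat => fun s => dF (profile a s)
    | 4%nat => fun s => profile_slope a s * (12 * profile a s ^ 2 - 4)
    | _ => fun s => dF (profile a s) * (12 * profile a s ^ 2 - 4)
                    + profile_slope a s ^ 2 * (24 * profile a s)
    end).
  assert (HD : forall k s, (k <= 4)%nat -> is_derive (D k) s (D (S k) s)).
  { intros k s Hk.
    assert (H0 := is_derive_profile_primitive a s).
    assert (H1 := is_derive_profile a s Ha).
    assert (H2 := is_derive_profile_slope a s Ha).
    destruct k as [| [| [| [| [| k]]]]]; [| | | | | lia]; simpl.
    - auto_derive; [eexists; exact H0 |].
      rewrite (Derive_of_is_derive _ _ _ H0); ring.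
    - exact H1.
    - exact H2.
    - unfold dF; auto_derive; [repeat split; eexists; exact H1 |].
      rewrite (Derive_of_is_derive _ _ _ H1); ring.
    - auto_derive; [repeat split; eexists; eassumption |].
      rewrite (Derive_of_is_derive _ _ _ H1), (Derive_of_is_derive _ _ _ H2).
      ring. }
  exists D; split; [split; [| split] | split].
  - intros s Hs; symmetry; now apply HY.
  - intros k s Hk _; apply D_in_of_is_derive, HD; lia.
  - intros k s Hk _; apply cont_deriv with (D (S k)).
    apply D_in_of_is_derive, HD; lia.
  - intros s _.
    apply Rminus_diag_eq; symmetry.
    exact (Derive_of_is_derive _ _ _ (HD 3%nat s ltac:(lia))).
  - intros s [-> | ->]; (split; [apply Rminus_diag |]).
    + apply profile_slope_0.
    + exact HL.
Qed.

(** The amplitude of a solution is its slope at [0]; the profile of this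
    amplitude solves the same initial value problem as the slope. *)
Lemma stationary_solution_iff (L : R) (Y : R -> R) :
  0 < L ->
  stationary_solution L Y <->
  exists a, a ^ 2 <= 1 /\ profile_slope a L = 0 /\
            eq_up_to_constant L Y (profile_primitive a).
Proof.
  intros HL; split.
  - intros HY.
    destruct (stationary_solution_slope L Y HL HY)
      as (y & u & v & Hy & Hyc & Hyd & Hsol & Hv0 & HvL).
    assert (Ha0 := neumann_amplitude_le_1 L u v HL Hsol Hv0 HvL).
    set (a := u 0) in *.
    assert (Ha : a ^ 2 <= 1) by nra.
    assert (Hu := solves_unique L u v (profile a) (profile_slope a) HL Hsol
      (solves_profile L a Ha) (eq_sym (profile_0 a))
      (eq_trans Hv0 (eq_sym (profile_slope_0 a)))).
    exists a; split; [exact Ha |]; split.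
    + rewrite <- HvL; symmetry; apply Hu; lra.
    + exists (y 0 - profile_primitive a 0); intros s Hs.
      assert (H : y s - profile_primitive a s = y 0 - profile_primitive a 0).
      { apply (constant_of_derive L (fun t => y t - profile_primitive a t));
          [| | exact Hs].
        - intros t Ht; apply continuity_pt_minus; [now apply Hyc |].
          eapply continuity_pt_of_is_derive, is_derive_profile_primitive.
        - intros t Ht; replace 0 with (minus (u t) (profile a t)).
          + apply (is_derive_minus y (profile_primitive a)).
            * now apply Hyd.
            * apply is_derive_profile_primitive.
          + destruct (Hu t ltac:(lra)) as [-> _].
            apply (minus_eq_zero (G := R_AbelianGroup)). }
      rewrite <- Hy by exact Hs; lra.
  - intros [a [Ha [HaL [c Hc]]]].
    now apply stationary_profile_primitive with a c.
Qed.

(** Since [phase_speed] does not vanish for [a ^ 2 < 1], the slope of a nonzero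
    profile vanishes exactly when the phase is a multiple of [PI]. *)
Lemma profile_slope_eq_0 (L a : R) :
  0 < L -> a ^ 2 <= 1 ->
  profile_slope a L = 0 <->
  a = 0 \/ a ^ 2 = 1 \/
  (a ^ 2 < 1 /\ exists k : Z, (1 <= k)%Z /\ IZR k * half_period (a ^ 2) = L).
Proof.
  intros HL Ha; split.
  - intros H.
    destruct (Req_dec a 0) as [| Ha0]; [now left | right].
    destruct Ha as [Ha | Ha]; [right | now left].
    split; [exact Ha |].
    assert (Hg := phase_speed_pos (a ^ 2) (phase (a ^ 2) L) Ha).
    assert (Hp := phase_pos (a ^ 2) L Ha HL).
    assert (HPI := PI_RGT_0).
    assert (Hsin : sin (phase (a ^ 2) L) = 0).
    { unfold profile_slope in H.
      apply Rmult_integral in H; destruct H as [H | H]; [| lra].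
      apply Rmult_integral in H; destruct H as [H | H]; [lra | exact H]. }
    destruct (sin_eq_0_0 _ Hsin) as [k Hk].
    assert (Hk0 : (0 < k)%Z) by (apply lt_IZR; nra).
    exists k; split; [lia |].
    apply phase_eq_mult_PI; [exact Ha | lia | exact Hk].
  - intros [-> | [H | [H [k [Hk Hh]]]]].
    + unfold profile_slope; ring.
    + now apply profile_slope_1.
    + apply phase_eq_mult_PI in Hh; [| exact H | lia].
      unfold profile_slope; rewrite Hh.
      rewrite (sin_eq_0_1 (IZR k * PI)) by now exists k.
      ring.
Qed.

(** The derivative at [0] is the amplitude. *)
Lemma profile_primitive_injective (L a b : R) :
  0 < L -> eq_up_to_constant L (profile_primitive a) (profile_primitive b) ->
  a = b.
Proof.
  intros HL [c Hc].
  assert (H : minus (profile a 0) (profile b 0) = 0).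
  { apply derive_of_constant_right
      with (fun t => minus (profile_primitive a t) (profile_primitive b t)) 0 L.
    - exact HL.
    - intros t Ht; unfold minus, plus, opp; simpl.
      rewrite (Hc t), (Hc 0) by (unfold closedI; lra); ring.
    - apply (is_derive_minus (profile_primitive a) (profile_primitive b));
        apply is_derive_profile_primitive. }
  rewrite !profile_0 in H; unfold minus, plus, opp in H; simpl in H; lra.
Qed.

(** Were the primitive affine, the profile would be constant, equal to its value
    [a] at [0], and then [dF a = 0]. *)
Lemma profile_primitive_nonaffine (L a : R) :
  0 < L -> a <> 0 -> a ^ 2 < 1 -> ~ affine_on L (profile_primitive a).
Proof.
  intros HL Ha0 Ha1 [m [b Hb]].
  assert (Hu : forall s, 0 <= s < L -> profile a s = m).
  { intros s Hs.
    assert (H : minus (profile a s) m = 0).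
    { apply derive_of_constant_right
        with (fun t => minus (profile_primitive a t) (m * t)) s L.
      - lra.
      - intros t Ht; unfold minus, plus, opp; simpl.
        rewrite (Hb t), (Hb s) by (unfold closedI; lra); ring.
      - apply (is_derive_minus (profile_primitive a) (fun t => m * t)).
        + apply is_derive_profile_primitive.
        + auto_derive; [easy | ring]. }
    unfold minus, plus, opp in H; simpl in H; lra. }
  assert (Hv : forall s, 0 <= s < L -> profile_slope a s = 0).
  { intros s Hs; apply derive_of_constant_right with (profile a) s L.
    - lra.
    - intros t Ht; rewrite !Hu; lra.
    - apply is_derive_profile; lra. }
  assert (HdF : dF (profile a 0) = 0).
  { apply derive_of_constant_right with (profile_slope a) 0 L.
    - lra.
    - intros t Ht; rewrite !Hv; lra.
    - apply is_derive_profile_slope; lra. }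
  rewrite profile_0, dF_eq_0 in HdF; lra.
Qed.

(** * Counting the resonant amplitudes *)

(** The intermediate value theorem for [half_period], which takes the value
    [PI / 2 < L / k] at [0] and exceeds [L] near [1]. *)
Lemma amplitude_exists (L : R) (k : Z) :
  (1 <= k)%Z -> IZR k * (PI / 2) < L ->
  exists a, 0 < a < 1 /\ IZR k * half_period (a ^ 2) = L.
Proof.
  intros Hk HkL.
  assert (HPI := PI_RGT_0).
  apply IZR_le in Hk.
  assert (HL : 0 < L) by nra.
  destruct (half_period_unbounded (L + 1)) as [q [Hq HqL]]; [lra |].
  destruct (IVT_interv (fun p => IZR k * half_period p - L) 0 q)
    as [p [Hp Heq]].
  - intros p Hp.
    apply continuity_pt_minus; [| apply continuity_pt_const; now intros ? ?].
    apply continuity_pt_mult; [apply continuity_pt_const; now intros ? ? |].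
    apply half_period_continuous; lra.
  - lra.
  - rewrite half_period_0; lra.
  - assert (0 <= (IZR k - 1) * half_period q) by (apply Rmult_le_pos; lra).
    lra.
  - assert (Hp0 : 0 < p).
    { destruct (Req_dec p 0) as [Hz | Hz]; [| lra].
      rewrite Hz, half_period_0 in Heq; lra. }
    exists (sqrt p); split.
    + split; [now apply sqrt_lt_R0 |].
      rewrite <- sqrt_1; apply sqrt_lt_1_alt; lra.
    + rewrite pow2_sqrt; lra.
Qed.

Definition amplitude (L : R) (k : Z) : R :=
  epsilon (inhabits 0)
    (fun a => 0 < a < 1 /\ IZR k * half_period (a ^ 2) = L).

Lemma amplitude_spec (L : R) (k : Z) :
  (1 <= k)%Z -> IZR k * (PI / 2) < L ->
  0 < amplitude L k < 1 /\ IZR k * half_period (amplitude L k ^ 2) = L.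
Proof.
  intros Hk HkL.
  exact (epsilon_spec (inhabits 0) _ (amplitude_exists L k Hk HkL)).
Qed.

(** The amplitude of the [i]-th solution: for [2 <= |i|], as long as such an
    amplitude exists, it has [|i| - 1] half periods in [[0, L]], and the factor [sgn i] makes the enumeration odd, with
    the constant profile [0] at [i = 0]. *)
Definition branch (L : R) (i : Z) : R :=
  if (Z.abs i =? 1)%Z then IZR i
  else IZR (Z.sgn i) * amplitude L (Z.abs i - 1).

Lemma branch_opp (L : R) (i : Z) : branch L (- i) = - branch L i.
Proof.
  unfold branch; rewrite Z.abs_opp, Z.sgn_opp, !opp_IZR.
  destruct (_ =? _)%Z; ring.
Qed.

Lemma branch_ge_2 (L : R) (i : Z) :
  (2 <= i)%Z -> branch L i = amplitude L (i - 1).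
Proof.
  intros Hi; unfold branch.
  rewrite Z.abs_eq, Z.sgn_pos by lia.
  destruct (Z.eqb_spec i 1); [lia | ring].
Qed.

(** The bounds on [L] say that the [k >= 1] with [k PI / 2 < L] are exactly
    [1, ..., n].  As [half_period p > PI / 2] for [p > 0], only these [k] are
    possible; monotonicity of [half_period] makes the positive amplitude
    belonging to [k] unique. *)
Lemma affine_and_exactly_2n_of_length (L : R) (n : Z) :
  0 < L -> (0 <= n)%Z -> IZR n < 2 * L / PI <= IZR n + 1 ->
  affine_and_exactly_2n_nonaffine_solutions L n.
Proof.
  intros HL Hn Hlen.
  assert (HPI := PI_RGT_0).
  assert (HL2 : 2 * L / PI * (PI / 2) = L) by (field; lra).
  assert (Hres : forall i, (2 <= i <= n + 1)%Z ->
    0 < branch L i < 1 /\ IZR (i - 1) * half_period (branch L i ^ 2) = L).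
  { intros i Hi; rewrite branch_ge_2 by lia; apply amplitude_spec; [lia |].
    assert (IZR (i - 1) <= IZR n) by (apply IZR_le; lia); nra. }
  assert (Hb1 : branch L 1 = 1) by reflexivity.
  assert (Hb0 : branch L 0 = 0) by (unfold branch; simpl; ring).
  assert (Hpos : forall i, (1 <= i <= n + 1)%Z -> 0 < branch L i <= 1).
  { intros i Hi; destruct (Z.eq_dec i 1) as [-> |]; [lra |].
    generalize (Hres i ltac:(lia)); lra. }
  assert (Hinj : forall i j, (1 <= i <= n + 1)%Z -> (1 <= j <= n + 1)%Z ->
                 branch L i = branch L j -> i = j).
  { intros i j Hi Hj Hij.
    destruct (Z.eq_dec i 1) as [-> | Hi1];
      destruct (Z.eq_dec j 1) as [-> | Hj1].
    - reflexivity.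
    - generalize (Hres j ltac:(lia)); lra.
    - generalize (Hres i ltac:(lia)); lra.
    - destruct (Hres i ltac:(lia)) as [Ha Hia].
      destruct (Hres j ltac:(lia)) as [_ Hja].
      rewrite <- Hij in Hja.
      assert (Hh := half_period_gt (branch L i ^ 2) ltac:(nra)).
      assert (He : IZR (i - 1) = IZR (j - 1)).
      { apply Rmult_eq_reg_r with (half_period (branch L i ^ 2)); lra. }
      apply eq_IZR in He; lia. }
  (* Every index is [0] or, up to sign, one of [1, ..., n + 1]. *)
  assert (Hsign : forall P : Z -> Prop,
    P 0%Z -> (forall i, (1 <= i <= n + 1)%Z -> P i /\ P (- i)%Z) ->
    forall i, (Z.abs i <= n + 1)%Z -> P i).
  { intros P HP0 HP i Hi.
    destruct (Z_lt_le_dec i 0) as [Hi0 | Hi0].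
    - rewrite <- (Z.opp_involutive i); apply HP; lia.
    - destruct (Z.eq_dec i 0) as [-> |]; [exact HP0 | apply HP; lia]. }
  exists (fun i => profile_primitive (branch L i)).
  split; [| split; [| split; [| split; [| split; [| split]]]]].
  - intros s; rewrite Hb0; apply profile_primitive_0.
  - intros s; rewrite Hb1; apply profile_primitive_1.
  - intros i s; rewrite branch_opp; apply profile_primitive_opp.
  - intros i Hi; apply stationary_solution_iff; [exact HL |].
    exists (branch L i).
    assert (Hsol : branch L i ^ 2 <= 1 /\
      (branch L i = 0 \/ branch L i ^ 2 = 1 \/
       (branch L i ^ 2 < 1 /\ exists k : Z, (1 <= k)%Z /\
          IZR k * half_period (branch L i ^ 2) = L))).
    { revert i Hi; apply Hsign.
      - rewrite Hb0; split; [lra | now left].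
      - intros i Hi; rewrite branch_opp.
        replace ((- branch L i) ^ 2) with (branch L i ^ 2) by ring.
        destruct (Z.eq_dec i 1) as [-> | Hi1].
        + rewrite Hb1; split; split; try lra; right; left; ring.
        + destruct (Hres i ltac:(lia)) as [Ha Hk].
          split; (split; [nra |]); right; right; (split; [nra |]);
            exists (i - 1)%Z; (split; [lia | exact Hk]). }
    destruct Hsol as [Ha Hcase].
    split; [exact Ha | split].
    + now apply profile_slope_eq_0.
    + exists 0; intros; ring.
  - intros i Hi; apply profile_primitive_nonaffine; [exact HL | |].
    + destruct (Z_lt_le_dec i 0) as [Hi0 | Hi0].
      * rewrite <- (Z.opp_involutive i), branch_opp.
        generalize (Hres (- i)%Z ltac:(lia)); lra.
      * generalize (Hres i ltac:(lia)); lra.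
    + destruct (Z_lt_le_dec i 0) as [Hi0 | Hi0].
      * rewrite <- (Z.opp_involutive i), branch_opp.
        generalize (Hres (- i)%Z ltac:(lia)); nra.
      * generalize (Hres i ltac:(lia)); nra.
  - intros i j Hi Hj H.
    apply profile_primitive_injective in H; [| exact HL].
    revert i Hi j Hj H.
    apply (Hsign (fun i => forall j, (Z.abs j <= n + 1)%Z ->
                                     branch L i = branch L j -> i = j)).
    + apply (Hsign (fun j => branch L 0 = branch L j -> 0%Z = j)).
      * reflexivity.
      * intros j Hj; rewrite branch_opp, Hb0.
        generalize (Hpos j Hj); split; lra.
    + intros i Hi; assert (Hi0 := Hpos i Hi); split.
      * apply (Hsign (fun j => branch L i = branch L j -> i = j));
          [rewrite Hb0; lra |].
        intros j Hj; rewrite branch_opp; assert (Hj0 := Hpos j Hj).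
        split; [now apply Hinj | lra].
      * rewrite branch_opp.
        apply (Hsign (fun j => - branch L i = branch L j -> (- i)%Z = j));
          [rewrite Hb0; lra |].
        intros j Hj; rewrite branch_opp; assert (Hj0 := Hpos j Hj).
        split; [lra |].
        intros H; f_equal; apply Hinj; auto; lra.
  - intros Y HY.
    apply stationary_solution_iff in HY; [| exact HL].
    destruct HY as [a [Ha [HaL HY]]].
    apply profile_slope_eq_0 in HaL; [| exact HL | exact Ha].
    assert (Hi : exists i, (Z.abs i <= n + 1)%Z /\ a = branch L i).
    { destruct HaL as [-> | [H1 | [H1 [k [Hk HkL]]]]].
      - exists 0%Z; split; [simpl; lia | now rewrite Hb0].
      - destruct (Rlt_or_le a 0) as [Hneg | Hnn].
        + exists (Z.opp 1); split; [simpl; lia |].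
          rewrite branch_opp, Hb1; nra.
        + exists 1%Z; split; [simpl; lia |]; rewrite Hb1; nra.
      - destruct (Req_dec a 0) as [-> | Ha0].
        { exists 0%Z; split; [simpl; lia | now rewrite Hb0]. }
        assert (H0 : 0 < a ^ 2) by now apply pow2_gt_0.
        assert (Hh := half_period_gt (a ^ 2) (conj H0 H1)).
        assert (Hkr : 1 <= IZR k) by now apply IZR_le.
        assert (Hkn : (k < n + 1)%Z).
        { apply lt_IZR; rewrite plus_IZR.
          apply Rlt_le_trans with (2 * L / PI); [| lra].
          apply Rmult_lt_reg_r with (PI / 2); [lra |].
          rewrite HL2, <- HkL; nra. }
        destruct (Hres (k + 1)%Z ltac:(lia)) as [Hb HbL].
        replace (k + 1 - 1)%Z with k in HbL by ring.
        assert (Habs : Rabs a = branch L (k + 1)).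
        { assert (Hsq : Rabs a ^ 2 = a ^ 2) by apply pow2_abs.
          assert (Hap := Rabs_pos_lt a Ha0).
          apply half_period_sqr_inj; [split; [exact Hap | nra] | exact Hb |].
          rewrite Hsq; apply Rmult_eq_reg_l with (IZR k); lra. }
        destruct (Rlt_or_le a 0) as [Hneg | Hnn].
        + exists (- (k + 1))%Z; split; [lia |].
          rewrite branch_opp, <- Habs, Rabs_left; lra.
        + exists (k + 1)%Z; split; [lia |].
          rewrite <- Habs, Rabs_pos_eq; lra. }
    destruct Hi as [i [Hi ->]]; now exists i.
Qed.

(* At a resonant length 2 L / PI = m the m-th pair has not bifurcated yet (as
   at L = PI / 2 in the first part), hence the separate last clause. *)
Theorem proposition1p1 (L : R) (HL : 0 < L) :
  (L <= PI / 2 ->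
     forall Y : R -> R,
       stationary_solution L Y <->
       (eq_up_to_constant L Y (fun _ => 0) \/
        eq_up_to_constant L Y (fun s => s) \/
        eq_up_to_constant L Y (fun s => - s))) /\
  (PI / 2 < L ->
     forall m : Z, m = Int_part (2 * L / PI) ->
       (1 <= m)%Z /\
       (2 * L / PI <> IZR m ->
          affine_and_exactly_2n_nonaffine_solutions L m) /\
       (2 * L / PI = IZR m ->
          affine_and_exactly_2n_nonaffine_solutions L (m - 1))).
Proof.
  assert (HPI := PI_RGT_0).
  assert (HL2 : 2 * L / PI * (PI / 2) = L) by (field; lra).
  split.
  - intros HLs Y; split.
    + intros HY.
      destruct (affine_and_exactly_2n_of_length L 0)
        as (Zf & Z0 & Z1 & Zopp & _ & _ & _ & Hall);
        [exact HL | lia | split; nra |].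
      destruct (Hall Y HY) as [i [Hi [c Hc]]].
      assert (Hcase : i = 0%Z \/ i = 1%Z \/ i = Z.opp 1) by lia.
      destruct Hcase as [-> | [-> | ->]]; [left | right; left | right; right];
        exists c; intros s Hs; rewrite (Hc s Hs).
      * now rewrite Z0.
      * now rewrite Z1.
      * now rewrite Zopp, Z1.
    + intros HY.
      assert (Ha : exists a, (a = 0 \/ a ^ 2 = 1) /\
                             eq_up_to_constant L Y (profile_primitive a)).
      { destruct HY as [[c Hc] | [[c Hc] | [c Hc]]].
        - exists 0; split; [now left | exists c; intros s Hs].
          now rewrite profile_primitive_0, Hc.
        - exists 1; split; [right; ring | exists c; intros s Hs].
          now rewrite profile_primitive_1, Hc.
        - exists (- (1)); split; [right; ring | exists c; intros s Hs].
          now rewrite profile_primitive_opp, profile_primitive_1, Hc. }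
      destruct Ha as [a [Ha Heq]].
      assert (Ha1 : a ^ 2 <= 1) by (destruct Ha as [-> | ->]; lra).
      apply stationary_solution_iff; [exact HL |].
      exists a; split; [exact Ha1 | split; [| exact Heq]].
      apply profile_slope_eq_0; tauto.
  - intros HLl m Hm.
    destruct (base_Int_part (2 * L / PI)) as [Hm1 Hm2].
    rewrite <- Hm in Hm1, Hm2.
    assert (H1 : 1 < 2 * L / PI).
    { apply Rmult_lt_reg_r with (PI / 2); lra. }
    assert (Hmpos : (0 < m)%Z) by (apply lt_IZR; lra).
    split; [lia | split]; intros Hres;
      apply affine_and_exactly_2n_of_length; try exact HL; try lia.
    + lra.
    + rewrite minus_IZR; lra.
Qed.
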